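(* Let $N,m\ge 1$ be integers and let $1<q<\infty$. Assume the following. (V0) $V:[0,\infty)\to[0,\infty)$ is non-increasing and $V(r)\to 0$ as $r\to\infty$. (W) For all $i,j=1,\dots,m$, $W_{ij}:(0,\infty)\to[0,\infty)$ is non-increasing and $x\mapsto W_{ij}(|x|)$ belongs to $L^q_w(\mathbb{R}^N)$. (h0) $h:[0,\infty)\to[0,\infty)$ is continuous, non-decreasing, $h(0)=0$, and there are $M>0$ and $\mu$ with $2\le\mu<2-\frac1q+\frac2N$ such that $h(s)\le M s^\mu$ for all $s\ge 0$. (h1) $h(ts)\ge t\,h(s)$ for all $t>1$ and $s\ge 0$. (G0) $G:(0,\infty)\times\mathbb{R}^m\to\mathbb{R}$ satisfies, for all $y\in\mathbb{R}^m$, $i\ne j$, $h',k>0$, $r>0$, $$G(r,y+h'e_i+ke_j)+G(r,y)\ge G(r,y+h'e_i)+G(r,y+ke_j),$$ and, for all $y\in\mathbb{R}^m$, $i\in\{1,\dots,m\}$, $h'>0$ and $0<r_0<r_1$, $$G(r_1,y+h'e_i)+G(r_0,y)\le G(r_1,y)+G(r_0,y+h'e_i),$$ where $\{e_i\}$ is the standard basis of $\mathbb{R}^m$. (G1) There are $K>0$ and exponents $0<\ell_j<\frac4N$ ($j=1,\dots,m$) such that for all $r>0$ and $s_1,\dots,s_m\ge 0$, $$0\le G(r,s_1,\dots,s_m)\le K\Big(\sum_{j=1}^m s_j+\sum_{j=1}^m s_j^{\frac{\ell_j+2}{2}}\Big).$$ (G2) For every $\varepsilon>0$ there are $R_0>0$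 and $S_0>0$ such that $G(r,s_1,\dots,s_m)\le\varepsilon\sum_{j=1}^m s_j$ for all $r>R_0$ and all $0\le s_1,\dots,s_m<S_0$. (G3) For all $r>0$, $s_1,\dots,s_m\ge0$ and $t>1$, $G(r,ts_1,\dots,ts_m)\ge t\,G(r,s_1,\dots,s_m)$. Let $c>0$ be such that $I_c=\inf_{\Phi\in\mathcal{S}_c}\mathcal{E}(\Phi)<0$, and let $\Phi_0\in\mathcal{H}^1(\mathbb{R}^N)$ be a Schwarz symmetric function which is the weak limit in $\mathcal{H}^1(\mathbb{R}^N)$ of a minimizing sequence $(\Phi_n)\subset\mathcal{S}_c$ for $I_c$ and which satisfies $\mathcal{E}(\Phi_0)\le I_c$. Then $\mathcal{E}(\Phi_0)=I_c$.
   Context: $\mathcal{H}^1(\mathbb{R}^N)=H^1(\mathbb{R}^N;\mathbb{C})^m$, with elements $\Phi=(\Phi_1,\dots,\Phi_m)$ and $|\Phi|^2=\sum_{j}|\Phi_j|^2$. $L^q_w(\mathbb{R}^N)$ denotes the weak Lebesgue space (weak $L^q$). The function $G$ is measurable in its first variable and continuous in the remaining $m$ variables on $[0,\infty)^m$. The energy functional is $$\mathcal{E}(\Phi)=\frac12\sum_{j=1}^m\int_{\mathbb{R}^N}|\nabla\Phi_j|^2dx-\frac12\int_{\mathbb{R}^N}V(|x|)|\Phi|^2dx-\int_{\mathbb{R}^N}G(|x|,|\Phi_1|^2,\dots,|\Phi_m|^2)dx-\frac12\sum_{i,j=1}^m\iint W_{ij}(|x-y|)h(|\Phi_i(x)|)h(|\Phi_j(y)|)\,dx\,dy,$$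 and, for $c>0$, $\mathcal{S}_c=\{\Phi\in\mathcal{H}^1(\mathbb{R}^N):\sum_{j=1}^m\int|\Phi_j|^2dx=c\}$. A vector function is called Schwarz symmetric if each of its components is nonnegative and equal a.e. to its own symmetric decreasing rearrangement (Schwarz symmetrization) about the origin. A minimizing sequence for $I_c$ is a sequence $(\Phi_n)\subset\mathcal{S}_c$ with $\mathcal{E}(\Phi_n)\to I_c$. *)

(* Defs.v *)
From HB Require Import structures.
From mathcomp Require Import all_boot all_order all_algebra.
From mathcomp Require Import complex.
From mathcomp Require Import all_classical all_reals all_analysis.

Set Implicit Arguments.
Unset Strict Implicit.
Unset Printing Implicit Defensive.

Import Order.TTheory GRing.Theory Num.Theory.
Import numFieldNormedType.Exports.
Import ComplexField.Normc.

Local Open Scope classical_set_scope.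
Local Open Scope ring_scope.

Section rV_measurable.
Context {R : realType} {n : nat}.

Definition rVcoord (i : 'I_n) (x : 'rV[R]_n) : R := x 0 i.

Let rV0 : g_sigma_preimage rVcoord set0.
Proof. exact: sigma_algebra0. Qed.

Let rVC A : g_sigma_preimage rVcoord A -> g_sigma_preimage rVcoord (~` A).
Proof. exact: sigma_algebraC. Qed.

Let rVbigcup (F : (set 'rV[R]_n)^nat) :
  (forall i, g_sigma_preimage rVcoord (F i)) ->
  g_sigma_preimage rVcoord (\bigcup_i (F i)).
Proof. exact: sigma_algebra_bigcup. Qed.

(* The product sigma-algebra, that is the Borel sigma-algebra of R^n. *)
HB.instance Definition _ :=
  @isMeasurable.Build (measure_tuple_display default_measure_display)
    'rV[R]_n (g_sigma_preimage rVcoord) rV0 rVC rVbigcup.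

End rV_measurable.

Lemma measurable_rVcoord (R : realType) n (i : 'I_n) :
  measurable_fun [set: 'rV[R]_n] (rVcoord i).
Proof.
move=> _ Y mY; rewrite setTI; apply: sub_sigma_algebra => /=.
rewrite -bigcup_seq/=; exists i => /=; first by rewrite mem_index_enum.
by exists Y => //; rewrite setTI.
Qed.

Lemma measurable_fun_rV (R : realType) d (T : measurableType d) n
    (f : T -> 'rV[R]_n) :
  (forall i, measurable_fun [set: T] (rVcoord i \o f)) ->
  measurable_fun [set: T] f.
Proof.
move=> mf.
suff H : g_sigma_preimage (fun i => rVcoord i \o f) `<=` measurable.
  move=> _ A mA; rewrite setTI; apply: H.
  rewrite g_sigma_preimage_comp; exists A => //.
  by rewrite setTI.
apply: smallest_sub; first exact: sigma_algebra_measurable.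
case: n => [|n] in f mf *; first by rewrite big_ord0.
rewrite -bigcup_mkord_ord; apply: bigcup_sub => i Ii.
by move=> A [B mB <-]; exact: mf.
Qed.

Definition rVcons (R : realType) n (p : R * 'rV[R]_n) : 'rV[R]_n.+1 :=
  \row_i oapp (p.2 0) p.1 (unlift ord0 i).

Lemma measurable_rVcons (R : realType) n :
  measurable_fun [set: R * 'rV[R]_n] (@rVcons R n).
Proof.
apply: measurable_fun_rV => i.
case: (unliftP ord0 i) => [j ->|->].
  rewrite (_ : _ \o _ = rVcoord j \o snd).
    by apply: measurableT_comp; [exact: measurable_rVcoord|exact: measurable_snd].
  by apply/funext => p; rewrite /= /rVcoord /rVcons mxE liftK.
rewrite (_ : _ \o _ = fst); first exact: measurable_fst.
by apply/funext => p; rewrite /= /rVcoord /rVcons mxE unlift_none.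
Qed.

Section lebesgue_succ.
Context {R : realType} {n : nat}.
Variable nu : {sigma_finite_measure set 'rV[R]_n -> \bar R}.
Local Open Scope ereal_scope.

Definition lebesgue_succ : set 'rV[R]_n.+1 -> \bar R :=
  pushforward (@lebesgue_measure R \x nu) (@rVcons R n).

Let mpre A : measurable A -> measurable (@rVcons R n @^-1` A).
Proof. by move=> mA; rewrite -[X in measurable X]setTI; exact: measurable_rVcons. Qed.

Let succ0 : lebesgue_succ set0 = 0.
Proof. by rewrite /lebesgue_succ /pushforward preimage_set0 measure0. Qed.

Let succ_ge0 A : 0 <= lebesgue_succ A.
Proof. by rewrite /lebesgue_succ /pushforward measure_ge0. Qed.

Let succ_sigma_additive : semi_sigma_additive lebesgue_succ.
Proof.
move=> F mF tF mUF; rewrite /lebesgue_succ /pushforward preimage_bigcup.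
apply: measure_semi_sigma_additive.
- by move=> k; exact: mpre.
- apply/trivIsetP => /= i j _ _ ij; rewrite -preimage_setI.
  by move/trivIsetP : tF => /(_ _ _ _ _ ij) ->//; rewrite preimage_set0.
- by rewrite -preimage_bigcup; exact: mpre.
Qed.

HB.instance Definition _ := isMeasure.Build _ _ _ lebesgue_succ
  succ0 succ_ge0 succ_sigma_additive.

Let succ_box (A : set R) (B : set 'rV[R]_n) :
  measurable A -> measurable B ->
  let C := [set x : 'rV[R]_n.+1 | A (x 0%R ord0) /\ B (\row_j x 0%R (lift ord0 j))] in
  measurable C /\ lebesgue_succ C = lebesgue_measure A * nu B.
Proof.
move=> mA mB C; split.
  have -> : C = (rVcoord ord0 @^-1` A) `&`
     ((fun x : 'rV[R]_n.+1 => \row_j x 0%R (lift ord0 j)) @^-1` B) by [].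
  apply: measurableI.
    by rewrite -[X in measurable X]setTI; exact: measurable_rVcoord.
  rewrite -[X in measurable X]setTI; apply: measurable_fun_rV => // j.
  rewrite (_ : _ \o _ = rVcoord (lift ord0 j)); first exact: measurable_rVcoord.
  by apply/funext => x; rewrite /= /rVcoord mxE.
rewrite -product_measure1E// /lebesgue_succ /pushforward; congr (_ _).
apply/seteqP; split => -[a b] /=; rewrite /C /rVcons /= !mxE unlift_none /=;
  (rewrite (_ : \row_j _ = b)//; apply/rowP => j; by rewrite !mxE liftK).
Qed.

Let succ_sigma_finite : sigma_finite setT lebesgue_succ.
Proof.
have /sigma_finiteP[F [TF ndF Foo]] := sigma_finiteT (@lebesgue_measure R).
have /sigma_finiteP[G [TG ndG Goo]] := sigma_finiteT nu.
exists (fun k => [set x : 'rV[R]_n.+1 |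
   F k (x 0%R ord0) /\ G k (\row_j x 0%R (lift ord0 j))]).
  apply/seteqP; split => // x _.
  have [k _ Fk] : (\bigcup_k F k) (x 0%R ord0) by rewrite -TF.
  have [l _ Gl] : (\bigcup_k G k) (\row_j x 0%R (lift ord0 j)) by rewrite -TG.
  exists (maxn k l) => //; split.
  - by move: Fk; exact/subsetPset/ndF/leq_maxl.
  - by move: Gl; exact/subsetPset/ndG/leq_maxr.
move=> k; have [mF Fk] := Foo k; have [mG Gk] := Goo k.
have [mC ->] := succ_box mF mG.
by split => //; rewrite lte_mul_pinfty// ge0_fin_numE.
Qed.

HB.instance Definition _ := Measure_isSigmaFinite.Build _ _ _ lebesgue_succ
  succ_sigma_finite.

End lebesgue_succ.

(* Lebesgue measure on R^n. *)
Fixpoint lebesgue_rV (R : realType) (n : nat) :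
    {sigma_finite_measure set 'rV[R]_n -> \bar R} :=
  match n with
  | 0 => \d_(0 : 'rV[R]_0)
  | n'.+1 => lebesgue_succ (lebesgue_rV R n')
  end.

Lemma lebesgue_rV_box (R : realType) n (A : 'I_n -> set R) :
  (forall i, measurable (A i)) ->
  lebesgue_rV R n [set x | forall i, A i (x 0 i)] =
  (\prod_(i < n) lebesgue_measure (A i))%E.
Proof.
elim: n A => [|n IH] A mA.
  rewrite big_ord0 /= diracE mem_set//= => -[].
  by [].
rewrite big_ord_recl -IH//=.
rewrite -product_measure1E//.
  rewrite /lebesgue_succ /pushforward; congr (_ _).
  apply/seteqP; split => -[a b] /=; rewrite /rVcons.
    move=> H; split; first by have := H ord0; rewrite mxE unlift_none.
    by move=> i; have := H (lift ord0 i); rewrite mxE liftK.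
  move=> [Ha Hb] i; rewrite mxE.
  by case: (unliftP ord0 i) => [j ->|->]/=.
  exact: mA.
rewrite [X in measurable X](_ : _ = \bigcap_(i in [set: 'I_n]) (rVcoord i @^-1` A (lift ord0 i))).
  apply: fin_bigcap_measurable => // i _.
  by rewrite -[X in measurable X]setTI; exact: measurable_rVcoord.
by apply/seteqP; split => [x H i _|x H i]; [exact: H|exact: H].
Qed.

Section sobolev.
Context {R : realType} {N : nat}.
Local Notation RN := 'rV[R]_N.
Local Notation mu := (lebesgue_rV R N).

(* The Euclidean norm; the library's norm on 'rV[R]_N is the sup norm. *)
Definition enorm (x : RN) : R := Num.sqrt (\sum_i x 0 i ^+ 2).

Definition iter_partial (s : seq 'I_N) (phi : RN -> R) : RN -> R :=
  foldr (fun k f => 'D_(delta_mx 0 k) f) phi s.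

Definition smooth (phi : RN -> R) : Prop :=
  forall s, continuous (iter_partial s phi) /\
    forall k x, derivable (iter_partial s phi) x (delta_mx 0 k).

Definition test_function (phi : RN -> R) : Prop :=
  smooth phi /\ compact (closure [set x | phi x != 0]).

Definition weak_partial (k : 'I_N) (u g : RN -> R) : Prop :=
  forall phi, test_function phi ->
    \int[mu]_x (u x * 'D_(delta_mx 0 k) phi x) = - \int[mu]_x (g x * phi x).

Definition sq_integral (f : RN -> R[i]) : \bar R :=
  (\int[mu]_x (normc (f x) ^+ 2)%:E)%E.

Definition L2 (f : RN -> R[i]) : Prop :=
  [/\ measurable_fun [set: RN] (fun x => complex.Re (f x)),
      measurable_fun [set: RN] (fun x => complex.Im (f x)) &
      (sq_integral f < +oo)%E].

(* H^1(R^N; C). An element is given by a representative of its class together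
   with a representative of its weak gradient; the latter is determined by the
   former up to a.e. equality. *)
Record sobolevH1 := SobolevH1 {
  H1_fun :> RN -> R[i];
  H1_grad : 'I_N -> RN -> R[i];
  H1_funL2 : L2 H1_fun;
  H1_gradL2 : forall k, L2 (H1_grad k);
  H1_gradRe : forall k, weak_partial k (fun x => complex.Re (H1_fun x))
                                       (fun x => complex.Re (H1_grad k x));
  H1_gradIm : forall k, weak_partial k (fun x => complex.Im (H1_fun x))
                                       (fun x => complex.Im (H1_grad k x)) }.

(* A^* : the open ball centred at 0 of volume mu A (R^N if mu A = +oo). *)
Definition sym_set (A : set RN) : set RN :=
  [set x | exists2 r : R,
             (mu [set y | (enorm y < r)%R] <= mu A)%E & enorm x < r].

(* The layer-cake formula f^*(x) = \int_0^oo 1_{ {|f| > t}^* }(x) dt. *)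
Definition sym_rearrangement (f : RN -> R[i]) (x : RN) : \bar R :=
  (\int[@lebesgue_measure R]_(t in `]0%R, +oo[)
     (\1_(sym_set [set y | (t < normc (f y))%R]) x : R)%:E)%E.

Definition schwarz_symmetric (f : RN -> R[i]) : Prop :=
  {ae mu, forall x, [/\ complex.Im (f x) = 0, 0 <= complex.Re (f x) &
                        (complex.Re (f x))%:E = sym_rearrangement f x]}.

Definition weakLp (q : R) (f : RN -> R) : Prop :=
  measurable_fun [set: RN] f /\
  exists C : R, forall t : R, 0 < t ->
    ((t `^ q)%:E * mu [set x | (t < `|f x|)%R] <= C%:E)%E.

End sobolev.

Arguments sobolevH1 : clear implicits.

Section product_space.
Context {R : realType} {N m : nat}.
Local Notation mu := (lebesgue_rV R N).
Local Notation H1m := ('I_m -> sobolevH1 R N).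

Definition H1_norm (Phi : H1m) : R :=
  Num.sqrt (fine (\sum_j (sq_integral (Phi j) +
                          \sum_k sq_integral (H1_grad (Phi j) k)))%E).

(* l is a bounded linear functional on H^1(R^N; C)^m. It is given on functions,
   but boundedness makes it insensitive to the choice of representatives. *)
Definition H1_dual (l : ('I_m -> 'rV[R]_N -> R[i]) -> R[i]) : Prop :=
  (forall (a : R[i]) (Phi Psi : H1m),
     l (fun j x => a * Phi j x + Psi j x) =
     a * l (fun j => H1_fun (Phi j)) + l (fun j => H1_fun (Psi j))) /\
  exists C : R, forall Phi : H1m,
    normc (l (fun j => H1_fun (Phi j))) <= C * H1_norm Phi.

Definition H1_weak_cvg (Phi_ : nat -> H1m) (Phi : H1m) : Prop :=
  forall l, H1_dual l ->
    normc (l (fun j => H1_fun (Phi_ n j)) - l (fun j => H1_fun (Phi j)))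
      @[n --> \oo] --> (0 : R).

Local Open Scope ereal_scope.

(* For nonnegative V, W, h and G the four terms lie in [0, +oo] and the first one
   is finite, so that the differences are meaningful. The values of G and of the
   W i j at r = 0 only matter on null sets. *)
Definition energy (V : R -> R) (W : 'I_m -> 'I_m -> R -> R) (h : R -> R)
    (G : R -> 'rV[R]_m -> R) (Phi : H1m) : \bar R :=
  (2^-1)%:E * \sum_j \int[mu]_x (\sum_k normc (H1_grad (Phi j) k x) ^+ 2)%:E
  - (2^-1)%:E * \int[mu]_x (V (enorm x) * \sum_j normc (Phi j x) ^+ 2)%:E
  - \int[mu]_x (G (enorm x) (\row_j normc (Phi j x) ^+ 2))%:E
  - (2^-1)%:E * \sum_i \sum_j \int[mu]_x \int[mu]_y
      (W i j (enorm (x - y)) * h (normc (Phi i x)) * h (normc (Phi j y)))%:E.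

Definition mass_sphere (c : R) : set H1m :=
  [set Phi | \sum_j sq_integral (Phi j) = c%:E].

Definition ground_energy V W h G (c : R) : \bar R :=
  ereal_inf [set energy V W h G Phi | Phi in mass_sphere c].

End product_space.

Arguments ground_energy {R} N {m} V W h G c.

(* Lebesgue (not only Borel) measurability on (0, +oo). The library's integral
   of a nonnegative f is the supremum of the integrals of the Borel simple
   functions below f, hence it is the usual one on Lebesgue measurable f. *)
Definition lebesgue_measurable_pos (R : realType) (f : R -> R) : Prop :=
  measurable_fun
    (`]0, +oo[%classic : set (caratheodory_type (wlength (@idfun R))^*%mu)) f.

(* Main.v *)
Require Import Defs.
From HB Require Import structures.
From mathcomp Require Import all_boot all_order all_algebra.
From mathcomp Require Import complex.
From mathcomp Require Import all_classical all_reals all_analysis.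
From mathcomp Require Import measurable_realfun ring lra.

(* Let a be the mass of Phi0. Testing the weak convergence against the pairing
   with Re Phi0 gives a <= c, and a > 0 because E(Phi0) < 0 = E(0). For
   t = sqrt (c / a) >= 1 the dilate t Phi0 has mass c, while the superlinearity
   of G and h gives E(t Phi0) <= t^2 E(Phi0). Hence
   I_c <= E(t Phi0) <= t^2 E(Phi0) <= E(Phi0) <= I_c, the third inequality
   because E(Phi0) < 0. *)

Set Implicit Arguments.
Unset Strict Implicit.
Unset Printing Implicit Defensive.

Import Order.TTheory GRing.Theory Num.Theory.
Import numFieldNormedType.Exports.

Local Open Scope classical_set_scope.
Local Open Scope ring_scope.

(** * Homogeneity and comparison of integrals of functions that may be non-measurable *)

Section integral_scaling.
Context d (T : measurableType d) (R : realType).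
Variable mu : {measure set T -> \bar R}.
Local Open Scope ereal_scope.

Import HBNNSimple.

(* The integral of a nonnegative function is a supremum over simple functions,
   hence no measurability is required. *)
Lemma ge0_le_integral_scale_ae (f g : T -> \bar R) (k : R) : (0 < k)%R ->
  (forall x, 0 <= f x) -> (forall x, 0 <= g x) ->
  {ae mu, forall x, k%:E * f x <= g x} ->
  k%:E * \int[mu]_x f x <= \int[mu]_x g x.
Proof.
move=> k0 f0 g0 [Z [mZ Z0 fgZ]].
rewrite -lee_pdivlMl// !ge0_integralTE//.
apply: ge_ereal_sup => _ [s /= sf <-].
rewrite lee_pdivlMl//.
have mnZ : measurable (~` Z) by exact: measurableC.
(* A simple function [s] below [f] is cut off on the exceptional null set [Z] and multiplied by [k];
   the result lies below [g] everywhere, so it competes in the supremum defining the integral of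
   [g]. *)
pose s' := scale_nnsfun (proj_nnsfun s mnZ) (ltW k0).
apply: ereal_sup_ubound; exists s'.
  move=> x /=; rewrite mindicE; have [xZ|xZ] := pselect (Z x).
    by rewrite memNset//= !mulr0.
  rewrite mem_set//= mulr1 EFinM.
  apply: (@le_trans _ _ (k%:E * f x)); first by rewrite lee_wpmul2l// lee_fin ltW.
  by apply: contra_notT xZ => h; apply: fgZ; exact/negP.
transitivity (k%:E * sintegral mu (proj_nnsfun s mnZ)).
  by rewrite -sintegralrM.
congr (_ * _).
(* The cut-off does not change the integral of [s], as [Z] has measure zero. *)
have := integral_nnsfun mu measurableT s; rewrite patch_setT => <-.
rewrite (ge0_negligible_integral mZ)//; last 2 first.
- exact/measurable_EFinP.
- by move=> x _; rewrite lee_fin.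
by rewrite setTD integral_nnsfun// mrestrict.
Qed.

(** Nonnegativity is asked only almost everywhere because the integrands built from [G] and [W] are
    controlled only at positive radii. The negative parts of [f] and [g] then have zero integral,
    and the positive parts are compared by [ge0_le_integral_scale_ae]. *)
Lemma le_integral_scale_ae (f g : T -> \bar R) (k : R) : (0 < k)%R ->
  {ae mu, forall x, 0 <= f x /\ k%:E * f x <= g x} ->
  0 <= \int[mu]_x f x /\ k%:E * \int[mu]_x f x <= \int[mu]_x g x.
Proof.
move=> k0 fg.
have neg0 (u : T -> \bar R) : {ae mu, forall x, 0 <= u x} ->
    \int[mu]_x u ^\- x = 0.
  move=> u0; apply/eqP; rewrite eq_le integral_ge0// andbT.
  rewrite -[leLHS]mul1e -(@integral0 _ _ _ mu setT).
  apply: ge0_le_integral_scale_ae => //.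
  apply: filterS u0 => x u0x.
  by rewrite mul1e funenegE ge_max lexx leeNl oppe0 u0x.
rewrite integralE neg0 ?sube0; last by apply: filterS fg => x [].
split; first exact: integral_ge0.
rewrite [X in _ <= X]integralE neg0 ?sube0; last first.
  apply: filterS fg => x [fx]; apply: le_trans.
  by rewrite mule_ge0// lee_fin ltW.
apply: ge0_le_integral_scale_ae => //.
apply: filterS fg => x [fx kfg].
by rewrite !funeposE (max_l fx) le_max kfg.
Qed.

(** For a nonnegative integrand the two inequalities come from comparison with the factors [k] and
    [k^-1]; positive and negative parts are then recombined. The sign of [f] is arbitrary so that
    the products occurring in [weak_partial] are covered. *)
Lemma integral_scale (f : T -> R) (k : R) : (0 < k)%R ->
  \int[mu]_x (k * f x)%:E = k%:E * \int[mu]_x (f x)%:E.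
Proof.
move=> k0.
have ge0 (u : T -> \bar R) : (forall x, 0 <= u x) ->
    \int[mu]_x (k%:E * u x) = k%:E * \int[mu]_x u x.
  move=> u0; apply/eqP; rewrite eq_le; apply/andP; split.
    rewrite -lee_pdivrMl//.
    apply: ge0_le_integral_scale_ae; rewrite ?invr_gt0//.
      by move=> x; rewrite mule_ge0// lee_fin ltW.
    by apply: aeW => x; rewrite lee_pdivrMl.
  apply: ge0_le_integral_scale_ae => //; last exact: aeW.
  by move=> x; rewrite mule_ge0// lee_fin ltW.
rewrite [LHS]integralE [in RHS]integralE.
rewrite (ge0_funeposM (EFin \o f) (ltW k0)) (ge0_funenegM (EFin \o f) (ltW k0)).
rewrite !ge0//.
set a := \int[mu]_x _; set b := \int[mu]_x _.
have : 0 <= a by exact: integral_ge0.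
have : 0 <= b by exact: integral_ge0.
(* If both parts are infinite, [+oo - +oo] is [-oo] by convention, a value that multiplication by
   [k > 0] preserves. *)
case: a b => [a| |] [b| |]//= _ _; rewrite ?gt0_muley ?gt0_muleNy//.
  by rewrite -!EFinM mulrBr.
Qed.

End integral_scaling.

(** * Complex moduli under multiplication by a real number *)

Section complex_scaling.
Context {R : realType}.
Implicit Types (t : R) (z : R[i]).

Lemma Re_scale t z : complex.Re (t%:C%C * z) = t * complex.Re z.
Proof. by case: z => a b /=; rewrite mul0r subr0. Qed.

Lemma Im_scale t z : complex.Im (t%:C%C * z) = t * complex.Im z.
Proof. by case: z => a b /=; rewrite mul0r addr0. Qed.

Lemma normc_sqrE z :
  ComplexField.Normc.normc z ^+ 2 = complex.Re z ^+ 2 + complex.Im z ^+ 2.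
Proof. by case: z => a b /=; rewrite sqr_sqrtr// addr_ge0// sqr_ge0. Qed.

Lemma normc_ge0 z : 0 <= ComplexField.Normc.normc z.
Proof. by case: z => a b; exact: sqrtr_ge0. Qed.

Lemma normc_le_ReIm z :
  ComplexField.Normc.normc z <= `|complex.Re z| + `|complex.Im z|.
Proof.
case: z => a b /=; rewrite -[leRHS]ger0_norm ?addr_ge0// -sqrtr_sqr ler_wsqrtr//.
rewrite -(real_normK (num_real a)) -(real_normK (num_real b)) sqrrD.
by rewrite lerD2r lerDl mulrn_wge0// mulr_ge0.
Qed.

Lemma normc_scale t z : 0 <= t ->
  ComplexField.Normc.normc (t%:C%C * z) = t * ComplexField.Normc.normc z.
Proof.
move=> t0; rewrite ComplexField.Normc.normcM; congr (_ * _) => /=.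
by rewrite expr0n/= addr0 sqrtr_sqr ger0_norm.
Qed.

End complex_scaling.

(** * Null sets where the radius vanishes *)

Section euclidean_space.
Context {R : realType} {N : nat}.
Local Notation RN := 'rV[R]_N.
Local Notation mu := (lebesgue_rV R N).

Lemma enorm_ge0 (x : RN) : 0 <= enorm x.
Proof. exact: sqrtr_ge0. Qed.

Lemma enorm_gt0 (x : RN) : x != 0 -> 0 < enorm x.
Proof.
move=> x0; rewrite sqrtr_gt0 lt0r sumr_ge0 ?andbT; last by move=> *; exact: sqr_ge0.
apply: contra x0; rewrite psumr_eq0; last by move=> *; exact: sqr_ge0.
move=> /allP xi0; apply/eqP/rowP => i; rewrite mxE.
by have := xi0 i (mem_index_enum _); rewrite /= sqrf_eq0 => /eqP.
Qed.

(** A point is a box with degenerate sides, so one zero factor annihilates its volume. In dimension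
    zero the measure is a Dirac mass at the only point, whence [0 < N]. *)
Lemma ae_neq_point (a : RN) : (0 < N)%N -> {ae mu, forall x, x != a}.
Proof.
move=> N0; exists [set x : RN | forall i, [set a 0 i] (x 0 i)]; split.
- rewrite [X in measurable X](_ : _ =
    \bigcap_(i in [set: 'I_N]) (rVcoord i @^-1` [set a 0 i])).
    apply: fin_bigcap_measurable => // i _.
    by rewrite -[X in measurable X]setTI; exact: measurable_rVcoord.
  by apply/seteqP; split => [x H i _|x H i]; exact: H.
- rewrite (@lebesgue_rV_box R N (fun i => [set a 0 i]))//.
  by rewrite (bigD1 (Ordinal N0))//= lebesgue_measure_set1 mul0e.
- by move=> x /= /negP/negPn/eqP ->.
Qed.

Lemma ae_enorm_gt0 : (0 < N)%N -> {ae mu, forall x : RN, 0 < enorm x}.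
Proof.
by move=> N0; apply: filterS (ae_neq_point 0 N0) => x; exact: enorm_gt0.
Qed.

Lemma ae_enormB_gt0 (x : RN) : (0 < N)%N -> {ae mu, forall y, 0 < enorm (x - y)}.
Proof.
move=> N0; apply: filterS (ae_neq_point x N0) => y yx.
by rewrite enorm_gt0// subr_eq0 eq_sym.
Qed.

End euclidean_space.

(** If the extended integral is infinite, both sides are [0], because [fine] sends the infinities to
    [0]. *)
Lemma Rintegral_scale d (T : measurableType d) (R : realType)
    (mu : {measure set T -> \bar R}) (f : T -> R) (k : R) : 0 < k ->
  \int[mu]_x (k * f x) = k * \int[mu]_x f x.
Proof.
move=> k0; rewrite /Rintegral integral_scale//.
by case: (integral _ _ _) => //=; rewrite ?gt0_muley ?gt0_muleNy//= mulr0.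
Qed.

(** * Dilates of Sobolev functions by a positive real factor *)

Section sobolev_scaling.
Context {R : realType} {N : nat}.
Variables (t : R) (t_gt0 : 0 < t).
Local Notation RN := 'rV[R]_N.

Lemma sq_integral_scale (f : RN -> R[i]) :
  sq_integral (fun x => t%:C%C * f x) = ((t ^+ 2)%:E * sq_integral f)%E.
Proof.
rewrite -integral_scale ?exprn_gt0//; apply: eq_integral => x _.
by rewrite normc_scale ?exprMn// ltW.
Qed.

Lemma L2_scale (f : RN -> R[i]) : L2 f -> L2 (fun x => t%:C%C * f x).
Proof.
case=> mRe mIm foo; split.
- under eq_fun do rewrite Re_scale.
  exact: measurable_funM.
- under eq_fun do rewrite Im_scale.
  exact: measurable_funM.
- by rewrite sq_integral_scale lte_mul_pinfty// lee_fin sqr_ge0.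
Qed.

Lemma weak_partial_scale (k : 'I_N) (u g : RN -> R) :
  weak_partial k u g ->
  weak_partial k (fun x => t * u x) (fun x => t * g x).
Proof.
move=> ug phi /ug ugphi.
under eq_Rintegral do rewrite -mulrA.
rewrite Rintegral_scale// ugphi.
under [in RHS]eq_Rintegral do rewrite -mulrA.
by rewrite Rintegral_scale// mulrN.
Qed.

Lemma weak_partial_Re_scale (k : 'I_N) (u g : RN -> R[i]) :
  weak_partial k (fun x => complex.Re (u x)) (fun x => complex.Re (g x)) ->
  weak_partial k (fun x => complex.Re (t%:C%C * u x))
                 (fun x => complex.Re (t%:C%C * g x)).
Proof.
move=> /weak_partial_scale; congr weak_partial;
  by apply/funext => x; rewrite Re_scale.
Qed.

Lemma weak_partial_Im_scale (k : 'I_N) (u g : RN -> R[i]) :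
  weak_partial k (fun x => complex.Im (u x)) (fun x => complex.Im (g x)) ->
  weak_partial k (fun x => complex.Im (t%:C%C * u x))
                 (fun x => complex.Im (t%:C%C * g x)).
Proof.
move=> /weak_partial_scale; congr weak_partial;
  by apply/funext => x; rewrite Im_scale.
Qed.

Definition scaleH1 (u : sobolevH1 R N) : sobolevH1 R N :=
  @SobolevH1 R N (fun x => t%:C%C * u x) (fun k x => t%:C%C * H1_grad u k x)
    (L2_scale (H1_funL2 u)) (fun k => L2_scale (H1_gradL2 u k))
    (fun k => weak_partial_Re_scale (H1_gradRe u k))
    (fun k => weak_partial_Im_scale (H1_gradIm u k)).

End sobolev_scaling.

(** * Extended-real arithmetic for the four terms of the energy *)

Section ereal_combination.
Context {R : realType}.
Local Open Scope ereal_scope.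
Implicit Types (k : R) (A B C D : \bar R).

(** [A] stands for the finite kinetic term, while the subtracted terms may be [+oo]. After [B'],
    [C'], [D'] are bounded below by [k] times [B], [C], [D], either everything is finite and [k]
    distributes, or the left side is [-oo]. *)
Lemma lee_scale_sub3 k A B C D B' C' D' : (0 < k)%R -> A \is a fin_num ->
  0 <= B /\ k%:E * B <= B' -> 0 <= C /\ k%:E * C <= C' ->
  0 <= D /\ k%:E * D <= D' ->
  k%:E * A - B' - C' - D' <= k%:E * (A - B - C - D).
Proof.
move=> k0 /fineK <- [B0 BB'] [C0 CC'] [D0 DD'].
apply: (@le_trans _ _ (k%:E * (fine A)%:E - k%:E * B - k%:E * C - k%:E * D)).
  by rewrite !leeB.
case: B B0 {BB'} => [b| |]// _; case: C C0 {CC'} => [c| |]// _;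
  case: D D0 {DD'} => [e| |]// _;
  rewrite /= ?gt0_muley ?gt0_muleNy ?lte_fin//= ?leNye//.
by rewrite lee_fin !mulrBr.
Qed.

Lemma scale_lte0 k A : (1 <= k)%R -> A < 0 -> k%:E * A <= A.
Proof.
move=> k1; case: A => [a| |]//=; last first.
  by rewrite gt0_muleNy// lte_fin (lt_le_trans ltr01).
rewrite lte_fin -EFinM lee_fin => a0.
by rewrite ger_nMl.
Qed.

(** The pair of nonnegativity and scaled bound is also the conclusion of [le_integral_scale_ae] and
    the premise of [lee_scale_sub3], so it passes unchanged through nested sums and integrals. *)
Lemma sume_scale_bound (I : finType) k (F G : I -> \bar R) :
  (forall i, 0 <= F i /\ k%:E * F i <= G i) ->
  0 <= \sum_i F i /\ k%:E * \sum_i F i <= \sum_i G i.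
Proof.
move=> FG; split; first by apply: sume_ge0 => i _; case: (FG i).
rewrite ge0_sume_distrr; last by move=> i _; case: (FG i).
by apply: lee_sum => i _; case: (FG i).
Qed.

Lemma mule_scale_bound (a : R) k A B : (0 <= a)%R ->
  0 <= A /\ k%:E * A <= B -> 0 <= a%:E * A /\ k%:E * (a%:E * A) <= a%:E * B.
Proof.
move=> a0 [A0 AB]; split; first by rewrite mule_ge0.
by rewrite muleCA lee_wpmul2l.
Qed.

End ereal_combination.

(** * The energy of a vanishing function and of a dilate *)

Section energy_scaling.
Context {R : realType} {N m : nat}.
Local Notation RN := 'rV[R]_N.
Local Notation mu := (lebesgue_rV R N).
Local Notation normc := ComplexField.Normc.normc.
Variables (V : R -> R) (W : 'I_m -> 'I_m -> R -> R) (h : R -> R)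
  (G : R -> 'rV[R]_m -> R).
Hypotheses (N_gt0 : (0 < N)%N)
  (V_ge0 : forall r : R, 0 <= r -> 0 <= V r)
  (W_ge0 : forall i j (r : R), 0 < r -> 0 <= W i j r)
  (h_ge0 : forall s : R, 0 <= s -> 0 <= h s)
  (G_ge0 : forall (r : R) (s : 'rV[R]_m), 0 < r -> (forall j, 0 <= s 0 j) ->
     0 <= G r s).

Lemma sq_integral_fin (f : RN -> R[i]) : L2 f -> sq_integral f \is a fin_num.
Proof.
case=> _ _ foo; rewrite ge0_fin_numE//.
by apply: integral_ge0 => x _; rewrite lee_fin sqr_ge0.
Qed.

Lemma measurable_sqr_normc (f : RN -> R[i]) : L2 f ->
  measurable_fun [set: RN] (fun x => normc (f x) ^+ 2).
Proof.
case=> mRe mIm _; under eq_fun do rewrite normc_sqrE.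
by apply: measurable_funD; exact: measurable_funX.
Qed.

Lemma kinetic_fin (u : sobolevH1 R N) :
  (\int[mu]_x (\sum_k normc (H1_grad u k x) ^+ 2)%:E)%E \is a fin_num.
Proof.
under eq_integral do rewrite -sumEFin.
rewrite ge0_integral_sum//=; last 2 first.
- by move=> k; apply/measurable_EFinP; exact: measurable_sqr_normc (H1_gradL2 u k).
- by move=> k x _; rewrite lee_fin sqr_ge0.
by rewrite sum_fin_num; apply/allP => e /mapP[k _ ->]; exact: sq_integral_fin (H1_gradL2 u k).
Qed.

Lemma integral_ae_eq0 (f : RN -> \bar R) :
  {ae mu, forall x, f x = 0%E} -> (\int[mu]_x f x = 0)%E.
Proof.
move=> f0; have [|I0 I1] := @le_integral_scale_ae _ _ _ mu f (cst 0%E) 1 ltr01.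
  by apply: filterS f0 => x ->; rewrite mule0.
by apply/eqP; rewrite eq_le I0 andbT -[leLHS]mul1e -(@integral0 _ _ _ mu setT).
Qed.

(** The three subtracted terms vanish and the kinetic term is nonnegative, so the weak gradient need
    not be shown to vanish. Contrapositively, negative energy excludes zero mass. *)
Lemma energy_ge0_of_ae_eq0 (Phi : 'I_m -> sobolevH1 R N) : h 0 = 0 ->
  (forall r : R, 0 < r -> G r 0 = 0) ->
  (forall j, {ae mu, forall x, normc (Phi j x) = 0}) ->
  (0 <= energy V W h G Phi)%E.
Proof.
move=> h0 G0 Phi0.
have Phi0' : {ae mu, forall x, forall j, normc (Phi j x) = 0}.
  by apply: filter_forall => j; exact: Phi0.
rewrite /energy [X in (_ - _ * X - _ - _)%E]integral_ae_eq0; last first.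
  apply: filterS Phi0' => x Phix.
  by rewrite big1 ?mulr0// => j _; rewrite Phix expr0n.
rewrite [X in (_ - X - _)%E]integral_ae_eq0; last first.
  apply: filterS2 (ae_enorm_gt0 N_gt0) Phi0' => x x0 Phix.
  rewrite [X in G _ X](_ : _ = 0) ?G0//.
  by apply/rowP => j; rewrite !mxE Phix expr0n.
rewrite [X in (_ - _ * X)%E]big1; last first.
  move=> i _; rewrite big1// => j _; apply: integral_ae_eq0.
  apply: filterS (Phi0 i) => x Phix.
  by apply: integral0_eq => y _; rewrite Phix h0 mulr0 mul0r.
rewrite mule0 !sube0 mule_ge0//.
apply: sume_ge0 => j _; apply: integral_ge0 => x _.
by rewrite lee_fin sumr_ge0// => k _; exact: sqr_ge0.
Qed.

(** The kinetic and potential terms are quadratic in the function and scale by [t ^+ 2]. The term in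
    [G] gains at least [t ^+ 2] since its arguments are squared moduli, and the interaction gains at
    least [t] from each of its two factors [h]. The last two enter with a minus sign. *)
Lemma energy_scaleH1 (Phi : 'I_m -> sobolevH1 R N) (t : R) (t0 : 0 < t) :
  (forall s : R, 0 <= s -> t * h s <= h (t * s)) ->
  (forall (r : R) (s : 'rV[R]_m), 0 < r -> (forall j, 0 <= s 0 j) ->
     t ^+ 2 * G r s <= G r (t ^+ 2 *: s)) ->
  (energy V W h G (fun j => scaleH1 t0 (Phi j)) <=
   (t ^+ 2)%:E * energy V W h G Phi)%E.
Proof.
move=> ht Gt.
have t2 : 0 < t ^+ 2 by rewrite exprn_gt0.
have half0 : (0 : R) <= 2^-1 by rewrite invr_ge0.
have nt z : normc (t%:C%C * z) = t * normc z by rewrite normc_scale ?ltW.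
rewrite /energy.
rewrite [X in (2^-1%:E * X - _ - _ - _)%E](_ : _ = (t ^+ 2)%:E *
    \sum_j \int[mu]_x (\sum_k normc (H1_grad (Phi j) k x) ^+ 2)%:E)%E; last first.
  rewrite ge0_sume_distrr; last first.
    move=> j _; apply: integral_ge0 => x _.
    by rewrite lee_fin sumr_ge0// => k _; exact: sqr_ge0.
  apply: eq_bigr => j _; rewrite -integral_scale//; apply: eq_integral => x _.
  by rewrite mulr_sumr; congr EFin; apply: eq_bigr => k _; rewrite /= nt exprMn.
rewrite muleCA; apply: lee_scale_sub3 => //.
- rewrite fin_numM// sum_fin_num; apply/allP => e /mapP[j _ ->].
  exact: kinetic_fin.
- apply: mule_scale_bound => //; apply: le_integral_scale_ae => //.
  apply: aeW => x; rewrite -EFinM !lee_fin; split.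
    by rewrite mulr_ge0 ?V_ge0 ?enorm_ge0// sumr_ge0// => j _; exact: sqr_ge0.
  rewrite mulrCA mulr_sumr ler_wpM2l ?V_ge0 ?enorm_ge0//.
  by apply: ler_sum => j _; rewrite /= nt exprMn.
- apply: le_integral_scale_ae => //.
  apply: filterS (ae_enorm_gt0 N_gt0) => x x0; rewrite -EFinM !lee_fin.
  have s0 j : 0 <= (\row_j normc (Phi j x) ^+ 2) 0 j by rewrite mxE sqr_ge0.
  split; first exact: G_ge0.
  apply: le_trans (Gt _ _ x0 s0) _; rewrite le_eqVlt; apply/orP; left; apply/eqP.
  by congr G; apply/rowP => j; rewrite !mxE /= nt exprMn.
- apply: mule_scale_bound => //; apply: sume_scale_bound => i.
  apply: sume_scale_bound => j; apply: le_integral_scale_ae => //.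
  apply: aeW => x; apply: le_integral_scale_ae => //.
  (* For fixed [x] the diagonal point [y = x] is discarded, since [W i j] is known to be nonnegative
     only at positive radii. *)
  apply: filterS (ae_enormB_gt0 x N_gt0) => y xy; rewrite -EFinM !lee_fin.
  have w0 := W_ge0 i j xy.
  have hx := h_ge0 (normc_ge0 (Phi i x)); have hy := h_ge0 (normc_ge0 (Phi j y)).
  split; first by rewrite !mulr_ge0.
  rewrite /= !nt (_ : t ^+ 2 * _ = W i j (enorm (x - y)) *
    ((t * h (normc (Phi i x))) * (t * h (normc (Phi j y))))); last by ring.
  rewrite -[leRHS]mulrA ler_wpM2l//.
  by rewrite ler_pM ?mulr_ge0 ?(ltW t0)// ht ?normc_ge0.
Qed.

End energy_scaling.

(** * The Cauchy-Schwarz inequality for real square-integrable functions *)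

Section square_integrable.
Context d (T : measurableType d) (R : realType).
Variable mu : {measure set T -> \bar R}.
Implicit Types u v : T -> R.

(** The product is dominated by [u ^+ 2 + v ^+ 2]. *)
Lemma integrable_mul_sqr u v :
  measurable_fun [set: T] u -> measurable_fun [set: T] v ->
  mu.-integrable [set: T] (fun x => (u x ^+ 2)%:E) ->
  mu.-integrable [set: T] (fun x => (v x ^+ 2)%:E) ->
  mu.-integrable [set: T] (fun x => (u x * v x)%:E).
Proof.
move=> mu_ mv iu iv.
have iuv := integrableD measurableT iu iv.
apply: le_integrable iuv => //; first exact/measurable_EFinP/measurable_funM.
move=> x _; rewrite /= lee_fin normrM.
rewrite (ger0_norm (addr_ge0 (sqr_ge0 _) (sqr_ge0 _))).
rewrite -(real_normK (num_real (u x))) -(real_normK (num_real (v x))).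
have := sqr_ge0 (`|u x| - `|v x|); have := normr_ge0 (u x); have := normr_ge0 (v x).
by nra.
Qed.

Lemma cauchy_schwarz_Rintegral u v :
  measurable_fun [set: T] u -> measurable_fun [set: T] v ->
  mu.-integrable [set: T] (fun x => (u x ^+ 2)%:E) ->
  mu.-integrable [set: T] (fun x => (v x ^+ 2)%:E) ->
  `|\int[mu]_x (u x * v x)| <=
  Num.sqrt (\int[mu]_x (u x ^+ 2)) * Num.sqrt (\int[mu]_x (v x ^+ 2)).
Proof.
move=> mu_ mv iu iv; have iuv := integrable_mul_sqr mu_ mv iu iv.
set A := \int[mu]_x (u x ^+ 2); set B := \int[mu]_x (u x * v x).
set F := \int[mu]_x (v x ^+ 2).
have A0 : 0 <= A by apply: Rintegral_ge0 => x _; exact: sqr_ge0.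
have F0 : 0 <= F by apply: Rintegral_ge0 => x _; exact: sqr_ge0.
(* Discriminant argument: the integral of [(s * u + v) ^+ 2] is a quadratic polynomial in [s] that
   is never negative. *)
have quad s : 0 <= s ^+ 2 * A + 2 * s * B + F.
  have -> : s ^+ 2 * A + 2 * s * B + F = \int[mu]_x ((s * u x + v x) ^+ 2).
    rewrite -!RintegralZl// -!RintegralD//.
    - by apply: eq_Rintegral => x _; ring.
    - apply: (@integrableD _ _ _ mu setT _ (fun x => (s ^+ 2 * u x ^+ 2)%:E)
        (fun x => (2 * s * (u x * v x))%:E)) => //.
        exact: (integrableZl measurableT (s ^+ 2) iu).
      exact: (integrableZl measurableT (2 * s) iuv).
    - exact: (integrableZl measurableT (s ^+ 2) iu).
    - exact: (integrableZl measurableT (2 * s) iuv).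
  by apply: Rintegral_ge0 => x _; exact: sqr_ge0.
rewrite -sqrtrM// -sqrtr_sqr ler_sqrt ?mulr_ge0//.
have [A00|An0] := eqVneq A 0.
  have [->|B0] := eqVneq B 0; first by rewrite expr0n mulr_ge0.
  (* With [A = 0] the polynomial is affine, and this [s] would give it the value [-1]. *)
  have := quad (- (F + 1) / (2 * B)).
  rewrite A00 mulr0 add0r (_ : 2 * _ * B = - (F + 1)); last by field.
  lra.
(* The minimizer of the quadratic, where its value is [F - B ^+ 2 / A]. *)
have := quad (- B / A).
rewrite (_ : _ + F = F - B ^+ 2 / A); last by field.
by rewrite subr_ge0 ler_pdivrMr ?lt0r ?An0// mulrC.
Qed.

End square_integrable.

(** * Mass of the weak limit, by duality *)

Section weak_limit_mass.
Context {R : realType} {N m : nat}.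
Local Notation RN := 'rV[R]_N.
Local Notation mu := (lebesgue_rV R N).
Local Notation normc := ComplexField.Normc.normc.
Implicit Types f : RN -> R[i].

Lemma integrable_sqr_normc f : L2 f ->
  mu.-integrable [set: RN] (fun x => (normc (f x) ^+ 2)%:E).
Proof.
move=> f2; apply/integrableP; split.
  by apply/measurable_EFinP; exact: measurable_sqr_normc.
under eq_integral do rewrite gee0_abs ?lee_fin ?sqr_ge0//.
by case: f2.
Qed.

Lemma integrable_sqr_Re f : L2 f ->
  mu.-integrable [set: RN] (fun x => (complex.Re (f x) ^+ 2)%:E).
Proof.
move=> f2; apply: le_integrable (integrable_sqr_normc f2) => //.
  by apply/measurable_EFinP/measurable_funX; case: f2.
by move=> x _; rewrite /= lee_fin !ger0_norm ?sqr_ge0// normc_sqrE lerDl sqr_ge0.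
Qed.

Lemma integrable_sqr_Im f : L2 f ->
  mu.-integrable [set: RN] (fun x => (complex.Im (f x) ^+ 2)%:E).
Proof.
move=> f2; apply: le_integrable (integrable_sqr_normc f2) => //.
  by apply/measurable_EFinP/measurable_funX; case: f2.
by move=> x _; rewrite /= lee_fin !ger0_norm ?sqr_ge0// normc_sqrE lerDr sqr_ge0.
Qed.

Lemma sq_integral_ge0 f : (0 <= sq_integral f)%E.
Proof. by apply: integral_ge0 => x _; rewrite lee_fin sqr_ge0. Qed.

Lemma sqrt_Rintegral_Re_le_H1_norm (Phi : 'I_m -> sobolevH1 R N) j :
  Num.sqrt (\int[mu]_x (complex.Re (Phi j x) ^+ 2)) <= H1_norm Phi /\
  Num.sqrt (\int[mu]_x (complex.Im (Phi j x) ^+ 2)) <= H1_norm Phi.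
Proof.
have f2 := H1_funL2 (Phi j).
have gk0 i : (0 <= \sum_k sq_integral (H1_grad (Phi i) k))%E.
  by apply: sume_ge0 => k _; exact: sq_integral_ge0.
(* Monotonicity of [fine] requires a finite upper bound; an infinite sum would make [H1_norm]
   zero. *)
have S_fin : (\sum_i (sq_integral (Phi i) +
    \sum_k sq_integral (H1_grad (Phi i) k)))%E \is a fin_num.
  rewrite sum_fin_num; apply/allP => e /mapP[i _ ->].
  rewrite /= fin_numD (sq_integral_fin (H1_funL2 (Phi i)))/= sum_fin_num.
  apply/allP => e' /mapP[k _ ->].
  exact: sq_integral_fin (H1_gradL2 (Phi i) k).
have normle : \int[mu]_x (normc (Phi j x) ^+ 2) <=
    fine (\sum_i (sq_integral (Phi i) +
      \sum_k sq_integral (H1_grad (Phi i) k)))%E.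
  apply: fine_le => //; first exact: sq_integral_fin f2.
  rewrite (bigD1 j)//= -addeA leeDl// adde_ge0//.
  by apply: sume_ge0 => i _; rewrite adde_ge0// sq_integral_ge0.
split; rewrite ler_wsqrtr// (le_trans _ normle)//; apply: le_Rintegral => //.
- exact: integrable_sqr_Re.
- exact: integrable_sqr_normc.
- by move=> x _; rewrite normc_sqrE lerDl sqr_ge0.
- exact: integrable_sqr_Im.
- exact: integrable_sqr_normc.
- by move=> x _; rewrite normc_sqrE lerDr sqr_ge0.
Qed.

(** The functional sending [F] to the sum of the integrals of [u j * F j], split into real and
    imaginary parts. It is complex linear without conjugation because [u] is real, which suffices
    for testing against an a.e. real limit. *)
Definition L2_pairing (u : 'I_m -> RN -> R) (F : 'I_m -> RN -> R[i]) : R[i] :=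
  Complex (\sum_j \int[mu]_x (u j x * complex.Re (F j x)))
          (\sum_j \int[mu]_x (u j x * complex.Im (F j x))).

Lemma H1_dual_L2_pairing (u : 'I_m -> RN -> R) :
  (forall j, measurable_fun [set: RN] (u j)) ->
  (forall j, mu.-integrable [set: RN] (fun x => (u j x ^+ 2)%:E)) ->
  H1_dual (L2_pairing u).
Proof.
move=> mu_ iu.
have mRe (Phi : 'I_m -> sobolevH1 R N) j :
    measurable_fun [set: RN] (fun x => complex.Re (Phi j x)).
  by case: (H1_funL2 (Phi j)).
have mIm (Phi : 'I_m -> sobolevH1 R N) j :
    measurable_fun [set: RN] (fun x => complex.Im (Phi j x)).
  by case: (H1_funL2 (Phi j)).
have iRe (Phi : 'I_m -> sobolevH1 R N) j := integrable_sqr_Re (H1_funL2 (Phi j)).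
have iIm (Phi : 'I_m -> sobolevH1 R N) j := integrable_sqr_Im (H1_funL2 (Phi j)).
have iuRe Phi j := integrable_mul_sqr (mu_ j) (mRe Phi j) (iu j) (iRe Phi j).
have iuIm Phi j := integrable_mul_sqr (mu_ j) (mIm Phi j) (iu j) (iIm Phi j).
split.
  move=> [a b] Phi Psi; rewrite /L2_pairing.
  have lin (p q r : RN -> R) (s t : R) :
      mu.-integrable [set: RN] (fun x => (p x)%:E) ->
      mu.-integrable [set: RN] (fun x => (q x)%:E) ->
      mu.-integrable [set: RN] (fun x => (r x)%:E) ->
      \int[mu]_x (s * p x + t * q x + r x) =
      s * \int[mu]_x p x + t * \int[mu]_x q x + \int[mu]_x r x.
    move=> ip iq ir.
    have isp := integrableZl measurableT s ip.
    have itq := integrableZl measurableT t iq.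
    have ispq := integrableD measurableT isp itq.
    by rewrite RintegralD// RintegralD// !RintegralZl.
  apply/eqP; rewrite eq_complex /=; apply/andP; split; apply/eqP.
    rewrite -mulNr !mulr_sumr -!big_split/=; apply: eq_bigr => j _.
    rewrite -lin//; apply: eq_Rintegral => x _.
    by case: (Phi j x) (Psi j x) => [p q] [r s] /=; ring.
  rewrite !mulr_sumr -!big_split/=; apply: eq_bigr => j _.
  rewrite -lin//; apply: eq_Rintegral => x _.
  by case: (Phi j x) (Psi j x) => [p q] [r s] /=; ring.
(* The factor 2 accounts for the real and imaginary parts, each bounded by Cauchy-Schwarz. *)
exists (2 * \sum_j Num.sqrt (\int[mu]_x (u j x ^+ 2))) => Phi.
rewrite (le_trans (normc_le_ReIm _))//= mulrDl mulrDl mul1r mulr_suml.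
by apply: lerD; rewrite (le_trans (ler_norm_sum _ _ _))//; apply: ler_sum => j _;
  rewrite (le_trans (cauchy_schwarz_Rintegral (mu_ j) _ (iu j) _))//
    ler_wpM2l//; case: (sqrt_Rintegral_Re_le_H1_norm Phi j).
Qed.

(** With [u] the real part of [Phi0] and [a] its mass, the pairing of [u] with [Phi_ n] has real
    part at most [(a + c) / 2], and its limit has real part [a]. Hence [a <= (a + c) / 2], that is
    [a <= c]. *)
Lemma weak_limit_mass_le (Phi_ : nat -> 'I_m -> sobolevH1 R N)
    (Phi0 : 'I_m -> sobolevH1 R N) (c : R) :
  (forall n, mass_sphere c (Phi_ n)) ->
  (forall j, {ae mu, forall x, complex.Im (Phi0 j x) = 0}) ->
  H1_weak_cvg Phi_ Phi0 ->
  (\sum_j sq_integral (Phi0 j) <= c%:E)%E.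
Proof.
move=> mass Im0 wk.
pose u j x := complex.Re (Phi0 j x).
have L2u j := H1_funL2 (Phi0 j).
have mu_ j : measurable_fun [set: RN] (u j) by case: (L2u j).
have iu j : mu.-integrable [set: RN] (fun x => (u j x ^+ 2)%:E).
  exact: integrable_sqr_Re.
have uE j : fine (sq_integral (Phi0 j)) = \int[mu]_x (u j x ^+ 2).
  congr fine; apply: ae_eq_integral => //.
  - by apply/measurable_EFinP; exact: measurable_sqr_normc.
  - exact/measurable_EFinP/measurable_funX.
  - apply: filterS (Im0 j) => x Imx _.
    by rewrite normc_sqrE Imx expr0n/= addr0.
have fineE Phi : (\sum_j sq_integral (Phi j : sobolevH1 R N) =
    (\sum_j fine (sq_integral (Phi j)))%:E)%E.
  rewrite -sumEFin; apply: eq_bigr => j _; rewrite fineK//.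
  exact: sq_integral_fin (H1_funL2 (Phi j)).
rewrite fineE lee_fin; set a := \sum_j _.
have aE : complex.Re (L2_pairing u Phi0) = a.
  by apply: eq_bigr => j _; rewrite uE; apply: eq_Rintegral => x _; rewrite -expr2.
(* Pointwise, [u * Re z <= (u ^+ 2 + |z| ^+ 2) / 2]; integration produces the masses [a] and [c]. *)
have lPhi n : complex.Re (L2_pairing u (Phi_ n)) <= (a + c) / 2.
  have := mass n; rewrite /mass_sphere/= fineE => -[<-].
  rewrite /a -big_split mulr_suml; apply: ler_sum => j _ /=; rewrite uE.
  have L2n := H1_funL2 (Phi_ n j).
  have mn : measurable_fun [set: RN] (fun x => complex.Re (Phi_ n j x)).
    by case: L2n.
  have iun := integrable_mul_sqr (mu_ j) mn (iu j) (integrable_sqr_Re L2n).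
  have inn := integrable_sqr_normc L2n.
  have isum := integrableD measurableT (iu j) inn.
  rewrite -[fine _]/(\int[mu]_x (normc (Phi_ n j x) ^+ 2)).
  rewrite -(RintegralD measurableT (iu j) inn).
  rewrite mulrC -RintegralZl//; apply: le_Rintegral => //.
    exact: (integrableZl measurableT 2^-1 isum).
  move=> x _; rewrite normc_sqrE.
  have := sqr_ge0 (u j x - complex.Re (Phi_ n j x)).
  have := sqr_ge0 (complex.Im (Phi_ n j x)).
  by lra.
have lim0 := wk _ (H1_dual_L2_pairing mu_ iu).
have normc_ge_norm_Re (z : R[i]) : - complex.Re z <= normc z.
  case: z => p r /=; rewrite (le_trans (ler_norm _))// normrN -sqrtr_sqr.
  by rewrite ler_wsqrtr// lerDl sqr_ge0.
(* The modulus of the difference of the pairings is at least [a - (a + c) / 2], and it tends to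
   [0]. *)
suff : (a - c) / 2 <= 0 by lra.
rewrite -(cvg_lim _ lim0)//; apply: limr_ge; first by apply/cvg_ex; exists 0.
apply: nearW => n; apply: le_trans (normc_ge_norm_Re _).
rewrite (_ : complex.Re _ = complex.Re (L2_pairing u (Phi_ n)) - a).
  by have := lPhi n; lra.
by rewrite -aE.
Qed.

End weak_limit_mass.

(** * Comparison of the weak limit with its dilate on the mass sphere *)

Theorem proposition4p5 (R : realType) (N m : nat) (q : R)
    (V : R -> R) (W : 'I_m -> 'I_m -> R -> R) (h : R -> R)
    (G : R -> 'rV[R]_m -> R)
    (N_ge1 : (1 <= N)%N) (m_ge1 : (1 <= m)%N) (q_gt1 : 1 < q)
    (V_ge0 : forall r : R, 0 <= r -> 0 <= V r)
    (V_noninc : forall r1 r2 : R, 0 <= r1 -> r1 <= r2 -> V r2 <= V r1)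
    (V_cvg0 : V r @[r --> +oo] --> (0 : R))
    (W_ge0 : forall i j (r : R), 0 < r -> 0 <= W i j r)
    (W_noninc : forall i j (r1 r2 : R), 0 < r1 -> r1 <= r2 -> W i j r2 <= W i j r1)
    (W_weakLq : forall i j, weakLp q (fun x : 'rV[R]_N => W i j (enorm x)))
    (h_ge0 : forall s : R, 0 <= s -> 0 <= h s)
    (h_cont : {within `[0, +oo[, continuous h})
    (h_nondec : forall s1 s2 : R, 0 <= s1 -> s1 <= s2 -> h s1 <= h s2)
    (h_0 : h 0 = 0)
    (h_growth : exists M mu : R,
       [/\ 0 < M, 2 <= mu, mu < 2 - q^-1 + 2 / N%:R &
           forall s : R, 0 <= s -> h s <= M * s `^ mu])
    (h_super : forall t s : R, 1 < t -> 0 <= s -> t * h s <= h (t * s))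
    (G_meas : forall s : 'rV[R]_m, (forall j, 0 <= s 0 j) ->
       lebesgue_measurable_pos (G ^~ s))
    (G_cont : forall r : R, 0 < r ->
       {within [set s : 'rV[R]_m | forall j, 0 <= s 0 j], continuous (G r)})
    (G_supermod : forall (y : 'rV[R]_m) (i j : 'I_m) (h' k r : R),
       i != j -> 0 < h' -> 0 < k -> 0 < r ->
       G r (y + h' *: delta_mx 0 i + k *: delta_mx 0 j) + G r y >=
       G r (y + h' *: delta_mx 0 i) + G r (y + k *: delta_mx 0 j))
    (G_submod : forall (y : 'rV[R]_m) (i : 'I_m) (h' r0 r1 : R),
       0 < h' -> 0 < r0 -> r0 < r1 ->
       G r1 (y + h' *: delta_mx 0 i) + G r0 y <=
       G r1 y + G r0 (y + h' *: delta_mx 0 i))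
    (G_growth : exists (K : R) (ell : 'I_m -> R),
       [/\ 0 < K, forall j, 0 < ell j < 4 / N%:R &
           forall (r : R) (s : 'rV[R]_m), 0 < r -> (forall j, 0 <= s 0 j) ->
             0 <= G r s <=
             K * (\sum_j s 0 j + \sum_j s 0 j `^ ((ell j + 2) / 2))])
    (G_small : forall eps : R, 0 < eps -> exists R0 S0 : R,
       [/\ 0 < R0, 0 < S0 &
           forall (r : R) (s : 'rV[R]_m), R0 < r -> (forall j, 0 <= s 0 j < S0) ->
             G r s <= eps * \sum_j s 0 j])
    (G_super : forall (r : R) (s : 'rV[R]_m) (t : R),
       0 < r -> (forall j, 0 <= s 0 j) -> 1 < t -> t * G r s <= G r (t *: s))
    (c : R) (c_gt0 : 0 < c)
    (I_lt0 : (ground_energy N V W h G c < 0)%E)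
    (Phi_ : nat -> 'I_m -> sobolevH1 R N)
    (Phi_mass : forall n, mass_sphere c (Phi_ n))
    (Phi_min : energy V W h G (Phi_ n) @[n --> \oo]
                 --> ground_energy N V W h G c)
    (Phi0 : 'I_m -> sobolevH1 R N)
    (Phi0_symm : forall j, schwarz_symmetric (Phi0 j))
    (Phi0_weak : H1_weak_cvg Phi_ Phi0)
    (Phi0_le : (energy V W h G Phi0 <= ground_energy N V W h G c)%E) :
  energy V W h G Phi0 = ground_energy N V W h G c.
Proof.
have [K [ell [K_gt0 ell_bd G_bd]]] := G_growth.
have G_ge0 (r : R) (s : 'rV[R]_m) : 0 < r -> (forall j, 0 <= s 0 j) -> 0 <= G r s.
  by move=> r0 s0; case/andP: (G_bd r s r0 s0).
have G_0 (r : R) : 0 < r -> G r 0 = 0.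
  move=> r0; have /(G_bd r 0 r0)/andP[G0 G0le] : forall j, 0 <= (0 : 'rV[R]_m) 0 j.
    by move=> j; rewrite mxE.
  apply/eqP; rewrite eq_le G0 andbT (le_trans G0le)// !big1 ?addr0 ?mulr0//.
    (* A zero base gives power [0] only for a nonzero exponent; here [(ell j + 2) / 2] is
       positive. *)
    move=> j _; rewrite mxE powR0// mulf_neq0// gt_eqF// addr_gt0//.
    by case/andP: (ell_bd j).
  by move=> j _; rewrite mxE.
have E_lt0 := le_lt_trans Phi0_le I_lt0.
(* Schwarz symmetry makes each component a.e. real. *)
have Im0 j : {ae lebesgue_rV R N, forall x, complex.Im (Phi0 j x) = 0}.
  by apply: filterS (Phi0_symm j) => x [].
have mass_le := weak_limit_mass_le Phi_mass Im0 Phi0_weak.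
have sq_fin j := sq_integral_fin (H1_funL2 (Phi0 j)).
have massE : (\sum_j sq_integral (Phi0 j) =
    (\sum_j fine (sq_integral (Phi0 j)))%:E)%E.
  by rewrite -sumEFin; apply: eq_bigr => j _; rewrite fineK.
set a := \sum_j fine _ in massE.
have sq_ge0 j : 0 <= fine (sq_integral (Phi0 j)).
  by rewrite fine_ge0// sq_integral_ge0.
have a_gt0 : 0 < a.
  rewrite lt0r sumr_ge0// andbT; apply: contraTN E_lt0.
  rewrite psumr_eq0// => /allP a0; rewrite -leNgt.
  apply: energy_ge0_of_ae_eq0 => // j.
  have mf := measurable_sqr_normc (H1_funL2 (Phi0 j)).
  have /(ae_eq_integral_abs _ measurableT) ae0 :
      measurable_fun [set: 'rV[R]_N]
        (fun x => (ComplexField.Normc.normc (Phi0 j x) ^+ 2)%:E).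
    exact/measurable_EFinP.
  have /ae0 : (\int[lebesgue_rV R N]_x
      `|(ComplexField.Normc.normc (Phi0 j x) ^+ 2)%:E| = 0)%E.
    under eq_integral do rewrite gee0_abs ?lee_fin ?sqr_ge0//.
    by rewrite -[LHS]fineK ?(eqP (a0 j (mem_index_enum _)))//; exact: sq_fin.
  apply: filterS => x /(_ I) [] /eqP.
  by rewrite sqrf_eq0 => /eqP.
have inf_le (Phi : 'I_m -> sobolevH1 R N) : mass_sphere c Phi ->
    (ground_energy N V W h G c <= energy V W h G Phi)%E.
  by move=> Phic; apply: ereal_inf_lbound; exists Phi.
apply/eqP; rewrite eq_le Phi0_le/=.
(* The case [a = c] is separate because the superlinearity hypotheses concern factors strictly above
   1; there [Phi0] itself lies on the sphere. *)
have /orP[/eqP ac|ac] : (a == c) || (a < c).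
  by rewrite -le_eqVlt -lee_fin -massE.
  by apply: inf_le; rewrite /mass_sphere/= massE ac.
have t_gt0 : 0 < Num.sqrt (c / a) by rewrite sqrtr_gt0 divr_gt0.
have t2 : Num.sqrt (c / a) ^+ 2 = c / a by rewrite sqr_sqrtr// divr_ge0// ltW.
have t2_gt1 : 1 < c / a by rewrite ltr_pdivlMr// mul1r.
have t_gt1 : 1 < Num.sqrt (c / a) by rewrite -sqrtr1 ltr_sqrt// (lt_trans ltr01).
apply: le_trans (inf_le (fun j => scaleH1 t_gt0 (Phi0 j)) _) _.
  rewrite /mass_sphere/=.
  under eq_bigr do rewrite sq_integral_scale//.
  rewrite -ge0_sume_distrr; last by move=> j _; exact: sq_integral_ge0.
  by rewrite massE t2 -EFinM divfK// gt_eqF.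
(* [h_super] is used with the factor [Num.sqrt (c / a)] and [G_super] with its square [c / a]. *)
apply: le_trans (energy_scaleH1 N_ge1 V_ge0 W_ge0 h_ge0 G_ge0 Phi0 t_gt0 _ _) _.
- by move=> s s0; exact: h_super.
- by move=> r s r0 s0; rewrite t2; exact: G_super.
- by rewrite t2 scale_lte0// ltW.
Qed.
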